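(* Let $N_2\in\mathbb{R}^{m\times n}$ be an entrywise nonnegative matrix of rank $2$ with no zero row and no zero column, with scaled singular value decomposition $N_2=\begin{bmatrix}\hat{\mathbf u}_1&\hat{\mathbf u}_2\end{bmatrix}\begin{bmatrix}\hat{\mathbf v}_1&\hat{\mathbf v}_2\end{bmatrix}^\top$, where $\hat{\mathbf u}_1$ and $\hat{\mathbf v}_1$ are entrywise positive. Let $\underline t_1,\overline t_1,\underline t_2,\overline t_2$ be any real parameters satisfying $$0<\max\nolimits_{\hat v}\le\underline t_1\le\overline t_1\le-1/\min\nolimits_{\hat u},\qquad 0<\max\nolimits_{\hat u}\le\underline t_2\le\overline t_2\le-1/\min\nolimits_{\hat v},$$ let $D_L,D_R$ be any $2\times 2$ diagonal matrices with positive diagonal entries, and set $$T_L=\frac{1}{\sqrt{\overline t_1\underline t_2+1}}\begin{bmatrix}1&\underline t_2\\ \overline t_1&-1\end{bmatrix},\qquad T_R^\top=\frac{1}{\sqrt{\underline t_1\overline t_2+1}}\begin{bmatrix}1&\overline t_2\\ \underline t_1&-1\end{bmatrix}.$$ Then, with $$L=\begin{bmatrix}\hat{\mathbf u}_1&\hat{\mathbf u}_2\end{bmatrix}T_LD_L,\qquad M=\left(D_RT_R^\top T_LD_L\right)^{-1},\qquad R^\top=D_RT_R^\top\begin{bmatrix}\hat{\mathbf v}_1^\top\\ \hat{\mathbf v}_2^\top\end{bmatrix},$$ one has $N_2=LMR^\top$, and the three matrices $L\in\mathbb{R}^{m\times2}$, $M\in\mathbb{R}^{2\times2}$, $R\in\mathbb{R}^{n\times2}$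 are entrywise nonnegative.
   Context: If $N_2=\sigma_1\mathbf u_1\mathbf v_1^\top+\sigma_2\mathbf u_2\mathbf v_2^\top$ is a singular value decomposition with $\sigma_1\ge\sigma_2>0$, the scaled singular value decomposition uses $\hat{\mathbf u}_k=\sigma_k^{1/2}\mathbf u_k$, $\hat{\mathbf v}_k=\sigma_k^{1/2}\mathbf v_k$ for $k=1,2$. Let $\hat u_{i,k}$ (resp. $\hat v_{j,k}$) denote the $i$-th (resp. $j$-th) entry of $\hat{\mathbf u}_k$ (resp. $\hat{\mathbf v}_k$), and define $$\min\nolimits_{\hat u}=\min_i\frac{\hat u_{i,2}}{\hat u_{i,1}},\quad \max\nolimits_{\hat u}=\max_i\frac{\hat u_{i,2}}{\hat u_{i,1}},\quad \min\nolimits_{\hat v}=\min_j\frac{\hat v_{j,2}}{\hat v_{j,1}},\quad \max\nolimits_{\hat v}=\max_j\frac{\hat v_{j,2}}{\hat v_{j,1}}.$$ *)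

(* Defs.v *)
From mathcomp Require Import all_boot all_order all_algebra.
From mathcomp Require Import reals.

Set Implicit Arguments.
Unset Strict Implicit.
Unset Printing Implicit Defensive.

Import Order.TTheory GRing.Theory Num.Theory.
Local Open Scope ring_scope.

(* On the empty index set (m = 0) both values are 0; this never arises for
   the row or column index set of a rank-2 matrix. *)
Definition fam_min (R : realType) (m : nat) (f : 'I_m -> R) : R :=
  \big[Num.min/head 0 (codom f)]_(x <- codom f) x.

Definition fam_max (R : realType) (m : nat) (f : 'I_m -> R) : R :=
  \big[Num.max/head 0 (codom f)]_(x <- codom f) x.

Lemma fam_min_le (R : realType) (m : nat) (f : 'I_m -> R) (i : 'I_m) :
  fam_min f <= f i.
Proof. by apply: (@ge_bigmin_seq _ _ _ _ _ (f i) _ id); rewrite ?codom_f. Qed.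

Lemma fam_min_attained (R : realType) (m : nat) (f : 'I_m -> R) :
  (0 < m)%N -> exists i, fam_min f = f i.
Proof.
move=> m0.
have hd : head 0 (codom f) \in codom f.
  have : size (codom f) = m by rewrite size_codom card_ord.
  by case: (codom f) => [|a s] /=; [move=> e; rewrite -e in m0 | rewrite mem_head].
suff : fam_min f \in codom f by move/codomP.
rewrite /fam_min big_seq; elim/big_ind: _ => // x y hx hy.
by rewrite /Num.min; case: ifP.
Qed.

Lemma fam_max_ge (R : realType) (m : nat) (f : 'I_m -> R) (i : 'I_m) :
  f i <= fam_max f.
Proof. by apply: (@le_bigmax_seq _ _ _ _ _ (f i) _ id); rewrite ?codom_f. Qed.

Lemma fam_max_attained (R : realType) (m : nat) (f : 'I_m -> R) :
  (0 < m)%N -> exists i, fam_max f = f i.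
Proof.
move=> m0.
have hd : head 0 (codom f) \in codom f.
  have : size (codom f) = m by rewrite size_codom card_ord.
  by case: (codom f) => [|a s] /=; [move=> e; rewrite -e in m0 | rewrite mem_head].
suff : fam_max f \in codom f by move/codomP.
rewrite /fam_max big_seq; elim/big_ind: _ => // x y hx hy.
by rewrite /Num.max; case: ifP.
Qed.

Definition min_ratio (R : realType) (m : nat) (x1 x2 : 'cV[R]_m) : R :=
  fam_min (fun i => x2 i 0 / x1 i 0).

Definition max_ratio (R : realType) (m : nat) (x1 x2 : 'cV[R]_m) : R :=
  fam_max (fun i => x2 i 0 / x1 i 0).

Definition mx_nonneg (R : realType) (m n : nat) (A : 'M[R]_(m, n)) : Prop :=
  forall i j, 0 <= A i j.

Definition mx_positive (R : realType) (m n : nat) (A : 'M[R]_(m, n)) : Prop :=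
  forall i j, 0 < A i j.

Definition orthonormal2 (R : realType) (m : nat) (x1 x2 : 'cV[R]_m) : Prop :=
  [/\ x1^T *m x1 = 1%:M, x2^T *m x2 = 1%:M & x1^T *m x2 = 0].

Definition is_svd2 (R : realType) (m n : nat) (N : 'M[R]_(m, n))
    (s1 s2 : R) (u1 u2 : 'cV[R]_m) (v1 v2 : 'cV[R]_n) : Prop :=
  [/\ orthonormal2 u1 u2, orthonormal2 v1 v2, s2 <= s1, 0 < s2
    & N = s1 *: (u1 *m v1^T) + s2 *: (u2 *m v2^T)].

Definition is_scaled_svd2 (R : realType) (m n : nat) (N : 'M[R]_(m, n))
    (uh1 uh2 : 'cV[R]_m) (vh1 vh2 : 'cV[R]_n) : Prop :=
  exists (s1 s2 : R) (u1 u2 : 'cV[R]_m) (v1 v2 : 'cV[R]_n),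
    is_svd2 N s1 s2 u1 u2 v1 v2 /\
    [/\ uh1 = Num.sqrt s1 *: u1, uh2 = Num.sqrt s2 *: u2,
        vh1 = Num.sqrt s1 *: v1 & vh2 = Num.sqrt s2 *: v2].

Definition mx22 (R : realType) (a b c d : R) : 'M[R]_2 :=
  \matrix_(i < 2, j < 2)
    if i == 0 then (if j == 0 then a else b) else (if j == 0 then c else d).

Definition positive_diag (R : realType) (n : nat) (D : 'M[R]_n) : Prop :=
  is_diag_mx D /\ forall i, 0 < D i i.

(* Main.v *)
(* Up to positive factors, row i of L is (u1 + t1up u2, t2lo u1 - u2) and row j
   of R is (v1 + t2up v2, t1lo v1 - v2), so their nonnegativity is exactly what
   the bounds on the parameters express.  The product D_R T_R^T T_L D_L has
   nonnegative diagonal, nonpositive off-diagonal entries and positive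
   determinant, so its adjugate, hence its inverse M, is nonnegative. *)
Require Import Defs.
From mathcomp Require Import all_boot all_order all_algebra.
From mathcomp Require Import reals ring lra.

Set Implicit Arguments.
Unset Strict Implicit.
Unset Printing Implicit Defensive.

Import Order.TTheory GRing.Theory Num.Theory.
Local Open Scope ring_scope.

Lemma mx22_mul (R : realType) (a b c d a' b' c' d' : R) :
  mx22 a b c d *m mx22 a' b' c' d' =
  mx22 (a * a' + b * c') (a * b' + b * d') (c * a' + d * c') (c * b' + d * d').
Proof.
apply/matrixP=> i j; rewrite !mxE !big_ord_recl big_ord0 !mxE /= addr0.
by case: (i == 0); case: (j == 0).
Qed.

Lemma mx22_eta (R : realType) (A : 'M[R]_2) :
  A = mx22 (A 0 0) (A 0 1) (A 1 0) (A 1 1).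
Proof.
apply/matrixP=> -[[|[|//]] hi] [[|[|//]] hj]; rewrite mxE /=;
  by congr (A _ _); apply: val_inj.
Qed.

Lemma positive_diag2P (R : realType) (D : 'M[R]_2) :
  positive_diag D -> exists a b, [/\ 0 < a, 0 < b & D = mx22 a 0 0 b].
Proof.
case=> /is_diag_mxP D0 Dpos; exists (D 0 0); exists (D 1 1); split=> //.
by rewrite [LHS]mx22_eta (D0 0 1) ?(D0 1 0).
Qed.

Lemma mx22_scale (R : realType) (k a b c d : R) :
  k *: mx22 a b c d = mx22 (k * a) (k * b) (k * c) (k * d).
Proof.
by apply/matrixP=> i j; rewrite !mxE; case: (i == 0); case: (j == 0).
Qed.

Lemma mx_nonneg_mx22 (R : realType) (a b c d : R) :
  0 <= a -> 0 <= b -> 0 <= c -> 0 <= d -> mx_nonneg (mx22 a b c d).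
Proof. by move=> *; move=> i j; rewrite mxE; case: ifP; case: ifP. Qed.

Lemma mx_nonnegM (R : realType) (m n p : nat)
    (A : 'M[R]_(m, n)) (B : 'M[R]_(n, p)) :
  mx_nonneg A -> mx_nonneg B -> mx_nonneg (A *m B).
Proof.
by move=> A0 B0 i j; rewrite mxE; apply: sumr_ge0 => k _; apply: mulr_ge0.
Qed.

Lemma mx_nonnegZ (R : realType) (m n : nat) (k : R) (A : 'M[R]_(m, n)) :
  0 <= k -> mx_nonneg A -> mx_nonneg (k *: A).
Proof. by move=> k0 A0 i j; rewrite mxE mulr_ge0. Qed.

Lemma positive_diag_nonneg (R : realType) (n : nat) (D : 'M[R]_n) :
  positive_diag D -> mx_nonneg D.
Proof.
case=> /is_diag_mxP D0 Dpos i j; have [->|ne_ij] := eqVneq i j; first exact: ltW.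
by rewrite D0 // -val_eqE.
Qed.

Lemma mx_nonneg_tr (R : realType) (m n : nat) (A : 'M[R]_(m, n)) :
  mx_nonneg A^T -> mx_nonneg A.
Proof. by move=> A0 i j; have := A0 j i; rewrite mxE. Qed.

Lemma mx22_inv_nonneg (R : realType) (a b c d : R) :
  0 <= a -> b <= 0 -> c <= 0 -> 0 <= d -> 0 < a * d - b * c ->
  mx22 a b c d \in unitmx /\ mx_nonneg (invmx (mx22 a b c d)).
Proof.
move=> a0 b0 c0 d0 det0; set A := mx22 a b c d.
(* The adjugate over the determinant. For square matrices a right inverse already gives
   invertibility, and it then coincides with [invmx A]. *)
set B := (a * d - b * c)^-1 *: mx22 d (- b) (- c) a.
have AB : A *m B = 1%:M.
  rewrite -scalemxAr mx22_mul.
  have -> : mx22 (a * d + b * - c) (a * - b + b * a)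
      (c * d + d * - c) (c * - b + d * a) = (a * d - b * c)%:M.
    rewrite [RHS]mx22_eta !mxE /= !mulr1n !mulr0n.
    by congr mx22; ring.
  by rewrite scale_scalar_mx mulVf // gt_eqF.
have [uA _] := mulmx1_unit AB; split=> //.
have -> : invmx A = B by rewrite -[invmx A]mulmx1 -AB mulKmx.
apply: mx_nonnegZ; first by rewrite invr_ge0 ltW.
by apply: mx_nonneg_mx22; rewrite ?oppr_ge0.
Qed.

(* A positive upper bound on [t] by [-1 / min] forces [min < 0], so the junk
   value [-1 / 0 = 0] is excluded. *)
Lemma ratio_bounds (R : realType) (m : nat) (x1 x2 : 'cV[R]_m) (s t : R) :
  mx_positive x1 -> max_ratio x1 x2 <= s -> 0 < t ->
  t <= -1 / min_ratio x1 x2 ->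
  forall i, 0 <= s * x1 i 0 - x2 i 0 /\ 0 <= x1 i 0 + t * x2 i 0.
Proof.
move=> x1pos maxs t0 tmin i; have xi := x1pos i 0.
have min0 : min_ratio x1 x2 < 0.
  by rewrite -invr_lt0; have := lt_le_trans t0 tmin; rewrite mulN1r oppr_gt0.
have tmin1 : - 1 <= t * min_ratio x1 x2 by rewrite -ler_ndivlMr.
have lo : min_ratio x1 x2 * x1 i 0 <= x2 i 0.
  by rewrite -ler_pdivlMr //; apply: (fam_min_le (fun i => x2 i 0 / x1 i 0)).
split.
  rewrite subr_ge0 -ler_pdivrMr //.
  exact: le_trans (fam_max_ge (fun i => x2 i 0 / x1 i 0) i) maxs.
(* With [mu] the least ratio, [t * x2 >= t * mu * x1 >= - x1] entrywise. *)
have := ler_wpM2l (ltW t0) lo; have := ler_wpM2r (ltW xi) tmin1.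
lra.
Qed.

(** The two columns of the product are [x1 + t * x2] and [s * x1 - x2], the quantities bounded in
    [ratio_bounds]. It serves both outer factors, the right one after transposition. *)
Lemma row_mx_mul_mx22_nonneg (R : realType) (m : nat) (x1 x2 : 'cV[R]_m)
    (s t : R) :
  (forall i, 0 <= s * x1 i 0 - x2 i 0 /\ 0 <= x1 i 0 + t * x2 i 0) ->
  mx_nonneg (row_mx x1 x2 *m mx22 1 s t (-1)).
Proof.
move=> H i j; have [H1 H2] := H i.
rewrite mxE (@big_split_ord _ _ _ 1 1) !big_ord1 row_mxEl row_mxEr !mxE /=.
by case: (j == 0); lra.
Qed.

Lemma scaled_svd2_mul (R : realType) (m n : nat) (N : 'M[R]_(m, n))
    (uh1 uh2 : 'cV[R]_m) (vh1 vh2 : 'cV[R]_n) :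
  is_scaled_svd2 N uh1 uh2 vh1 vh2 ->
  N = row_mx uh1 uh2 *m col_mx vh1^T vh2^T.
Proof.
move=> [s1 [s2 [u1 [u2 [v1 [v2 [[_ _ s21 s20 ->] [-> -> -> ->]]]]]]]].
have s10 := le_trans (ltW s20) s21.
by rewrite mul_row_col !linearZ /= -!scalemxAl !scalerA -!expr2 !sqr_sqrtr // ltW.
Qed.

(** The matrix [B *m invmx (A *m B)] is a right inverse of the square matrix [A], hence also a left
    inverse. This makes the factors between the two singular blocks cancel. *)
Lemma mulmx_invmx_mul (R : realType) (n : nat) (A B : 'M[R]_n) :
  A *m B \in unitmx -> B *m invmx (A *m B) *m A = 1%:M.
Proof. by move=> uAB; apply: mulmx1C; rewrite mulmxA mulmxV. Qed.

Theorem theorem2p12 (R : realType) (m n : nat) (N2 : 'M[R]_(m, n))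
    (uh1 uh2 : 'cV[R]_m) (vh1 vh2 : 'cV[R]_n)
    (t1lo t1up t2lo t2up : R) (DL DR TL TR M : 'M[R]_2)
    (L : 'M[R]_(m, 2)) (Rf : 'M[R]_(n, 2))
    (hN_nonneg : mx_nonneg N2)
    (hN_rank : \rank N2 = 2%N)
    (hN_row : forall i, row i N2 != 0)
    (hN_col : forall j, col j N2 != 0)
    (hsvd : is_scaled_svd2 N2 uh1 uh2 vh1 vh2)
    (huh1 : mx_positive uh1)
    (hvh1 : mx_positive vh1)
    (ht1 : [/\ 0 < max_ratio vh1 vh2, max_ratio vh1 vh2 <= t1lo,
               t1lo <= t1up & t1up <= -1 / min_ratio uh1 uh2])
    (ht2 : [/\ 0 < max_ratio uh1 uh2, max_ratio uh1 uh2 <= t2lo,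
               t2lo <= t2up & t2up <= -1 / min_ratio vh1 vh2])
    (hDL : positive_diag DL)
    (hDR : positive_diag DR)
    (hTL : TL = (1 / Num.sqrt (t1up * t2lo + 1)) *: mx22 1 t2lo t1up (-1))
    (hTR : TR^T = (1 / Num.sqrt (t1lo * t2up + 1)) *: mx22 1 t2up t1lo (-1))
    (hL : L = row_mx uh1 uh2 *m TL *m DL)
    (hM : M = invmx (DR *m TR^T *m TL *m DL))
    (hRf : Rf^T = DR *m TR^T *m col_mx vh1^T vh2^T) :
  [/\ DR *m TR^T *m TL *m DL \in unitmx,
      N2 = L *m M *m Rf^T,
      mx_nonneg L, mx_nonneg M & mx_nonneg Rf].
Proof.
case: ht1 => mv0 mvt1 t1le t1u; case: ht2 => mu0 mut2 t2le t2u.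
have t1lo0 := lt_le_trans mv0 mvt1; have t2lo0 := lt_le_trans mu0 mut2.
have t1up0 := lt_le_trans t1lo0 t1le; have t2up0 := lt_le_trans t2lo0 t2le.
have a0 : 0 < 1 / Num.sqrt (t1up * t2lo + 1).
  by rewrite divr_gt0 // sqrtr_gt0 addr_gt0 // mulr_gt0.
have b0 : 0 < 1 / Num.sqrt (t1lo * t2up + 1).
  by rewrite divr_gt0 // sqrtr_gt0 addr_gt0 // mulr_gt0.
have [unitX Minv] : DR *m TR^T *m TL *m DL \in unitmx /\
    mx_nonneg (invmx (DR *m TR^T *m TL *m DL)).
  have [p [q [p0 q0 ->]]] := positive_diag2P hDR.
  have [r [s [r0 s0 ->]]] := positive_diag2P hDL.
  (* Abstracting the normalising factors to positive scalars removes the square roots, so that the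
     entries become polynomials that [ring] can rearrange. *)
  rewrite hTL hTR; move: (1 / _) (1 / _) a0 b0 => a b a0 b0.
  rewrite !mx22_scale !mx22_mul.
  set k := b * a; have k0 : 0 < k by rewrite mulr_gt0.
  have P x y z : 0 < x -> 0 < y -> 0 <= z -> 0 <= k * (x * y) * z.
    by move=> x0 y0; apply: mulr_ge0; rewrite ltW // !mulr_gt0.
  have t12 : 0 < t1up * t2lo + 1 by rewrite addr_gt0 // mulr_gt0.
  have t21 : 0 < t1lo * t2up + 1 by rewrite addr_gt0 // mulr_gt0.
  apply: mx22_inv_nonneg.
  - rewrite [leRHS](_ : _ = k * (p * r) * (t1up * t2up + 1)); last by rewrite /k; ring.
    by apply: P => //; rewrite addr_ge0 // mulr_ge0 // ltW.
  (* The off-diagonal entries are negative multiples of the gaps [t2up - t2lo] and [t1up - t1lo]: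
     this is where the order of the parameters enters. *)
  - rewrite -oppr_ge0 [leRHS](_ : _ = k * (p * s) * (t2up - t2lo)); last by rewrite /k; ring.
    by apply: P => //; rewrite subr_ge0.
  - rewrite -oppr_ge0 [leRHS](_ : _ = k * (q * r) * (t1up - t1lo)); last by rewrite /k; ring.
    by apply: P => //; rewrite subr_ge0.
  - rewrite [leRHS](_ : _ = k * (q * s) * (t1lo * t2lo + 1)); last by rewrite /k; ring.
    by apply: P => //; rewrite addr_ge0 // mulr_ge0 // ltW.
  (* The determinant is multiplicative. Both transformation matrices have negative determinant, so
     the signs cancel. *)
  rewrite [ltRHS](_ : _ = (k * k) * (p * q * (r * s)) *
    ((t1up * t2lo + 1) * (t1lo * t2up + 1))); last by rewrite /k; ring.
  by rewrite !mulr_gt0.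
(* The pairing is crossed: the left ratios bound [t2lo] below and [t1up] above, the parameters of
   [TL]; the right ratios bound [t1lo] and [t2up], those of [TR]. *)
have Hu := ratio_bounds huh1 mut2 t1up0 t1u.
have Hv := ratio_bounds hvh1 mvt1 t2up0 t2u.
split=> //; last 2 first.
- by rewrite hM.
- apply: mx_nonneg_tr; rewrite hRf -mulmxA.
  apply: mx_nonnegM; first exact: positive_diag_nonneg.
  rewrite hTR -scalemxAl; apply: (mx_nonnegZ (ltW b0)).
  apply: mx_nonneg_tr; rewrite trmx_mul (tr_col_mx vh1^T) !trmxK.
  have -> : (mx22 1 t2up t1lo (-1))^T = mx22 1 t1lo t2up (-1).
    by apply/matrixP=> i j; rewrite !mxE; case: (i == 0); case: (j == 0).
  exact: row_mx_mul_mx22_nonneg.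
- rewrite hL hM hRf -!mulmxA; rewrite -!mulmxA in unitX.
  rewrite (scaled_svd2_mul hsvd); move: (row_mx _ _) (col_mx _ _) => U V.
  have := @mulmx_invmx_mul _ _ (DR *m TR^T) (TL *m DL).
  rewrite -!mulmxA => /(_ unitX) E.
  (* Regrouping isolates [TL *m DL *m M *m DR *m TR^T], which is the identity by [E]. *)
  by rewrite 4!(mulmxA _ _ V) E mul1mx.
- rewrite hL; apply: mx_nonnegM; last exact: positive_diag_nonneg.
  rewrite hTL -scalemxAr; apply: (mx_nonnegZ (ltW a0)).
  exact: row_mx_mul_mx22_nonneg.
Qed.
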